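(* Let $\Pi=(p_{ij})_{i,j=1}^d$ be a stochastic matrix such that $\dim(\mathrm{Fix}(\Pi))\ge 2$, where $\mathrm{Fix}(\Pi)=\{\psi\in\mathbb{C}^d:\Pi\psi=\psi\}$. Let $\Psi:M_d(\mathbb{C})\to M_d(\mathbb{C})$ be the Markov operator $\Psi(\mathbf{x})=\mathbf{1}\diamond P(\mathbf{x})$, where $P(\mathbf{x})_{ij}=\sum_{k,l=1}^d\sqrt{p_{ik}p_{jl}}\,x_{kl}$ for $\mathbf{x}=(x_{ij})\in M_d(\mathbb{C})$ and $\diamond$ denotes Schur (entrywise) multiplication. Then $\Psi$ is uniquely ergodic relative to $M_d(\mathbb{C})^\Psi$.
   Context: $M_d(\mathbb{C})$ is the $C^*$-algebra of $d\times d$ complex matrices, with unit $\mathbf{1}$ and the standard matrix units $e_{ij}$. A stochastic matrix is a matrix with nonnegative entries whose rows sum to $1$. Schur multiplication is $(\mathbf{x}\diamond\mathbf{y})_{ij}=x_{ij}y_{ij}$; thus $\Psi(\mathbf{x})$ is the diagonal part of $P(\mathbf{x})$. A Markov operator on a unital $C^*$-algebra $\mathfrak{A}$ is a positive linear map $T:\mathfrak{A}\to\mathfrak{A}$ with $T\mathbf{1}=\mathbf{1}$. For a Markov operator $T$ on a unital $C^*$-algebra $\mathfrak{A}$, put $\mathfrak{A}^T=\{x\in\mathfrak{A}:Tx=x\}$. A state of $\mathfrak{A}^T$ is a linear functional on $\mathfrak{A}^T$ that is nonnegative on the positive elements of $\mathfrak{A}$ lying in $\mathfrak{A}^T$ and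 takes the value $1$ at $\mathbf{1}$. $T$ (or $(\mathfrak{A},T)$) is uniquely ergodic relative to $\mathfrak{A}^T$ if every state of $\mathfrak{A}^T$ has a unique $T$-invariant state extension to $\mathfrak{A}$ (a state $\varphi$ of $\mathfrak{A}$ is $T$-invariant if $\varphi(Tx)=\varphi(x)$ for all $x\in\mathfrak{A}$). *)

(* Defs.v *)
From HB Require Import structures.
From mathcomp Require Import all_boot all_order all_algebra.
From mathcomp Require Import spectral complex reals.

Set Implicit Arguments.
Unset Strict Implicit.
Unset Printing Implicit Defensive.

Import Order.TTheory GRing.Theory Num.Theory.
Local Open Scope ring_scope.
Local Open Scope complex_scope.
Local Open Scope sesquilinear_scope.

Section MarkovOperators.
Variables (R : realType) (d : nat).
Local Notation C := R[i].
Local Notation A := 'M[C]_d.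

(* The positive elements of a C*-algebra are the elements y^* y; no order on
   matrices is involved. *)
Definition cstar_positive (x : A) : Prop := exists y : A, x = y ^t* *m y.

Record markov_operator := MarkovOperator {
  markov_fun :> 'End(A);
  markov_positive : forall x, cstar_positive x -> cstar_positive (markov_fun x);
  markov_unital : markov_fun 1%:M = 1%:M
}.

Implicit Type T : markov_operator.

Fact one_in_fixedSpace T : 1%:M \in fixedSpace T.
Proof. by apply/fixedSpaceP; rewrite markov_unital. Qed.

Definition fix_one T : subvs_of (fixedSpace T) := Subvs (one_in_fixedSpace T).

(* C^o is C seen as a one-dimensional vector space over itself, so that
   'Hom(_, C^o) is the space of C-linear functionals; equality of such
   functionals is pointwise equality. On C, 0 <= z means that z is real and
   nonnegative. *)
Definition state_on_fix T (omega : 'Hom(subvs_of (fixedSpace T), C^o)) : Prop :=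
  (forall x, cstar_positive (vsval x) -> 0 <= omega x) /\ omega (fix_one T) = 1.

Definition state (phi : 'Hom(A, C^o)) : Prop :=
  (forall x, cstar_positive x -> 0 <= phi x) /\ phi 1%:M = 1.

Definition invariant_state T (phi : 'Hom(A, C^o)) : Prop :=
  state phi /\ forall x, phi (T x) = phi x.

Definition extends_from_fix T (phi : 'Hom(A, C^o))
    (omega : 'Hom(subvs_of (fixedSpace T), C^o)) : Prop :=
  forall x, phi (vsval x) = omega x.

Definition uniquely_ergodic_rel_fix T : Prop :=
  forall omega : 'Hom(subvs_of (fixedSpace T), C^o), state_on_fix omega ->
  exists! phi : 'Hom(A, C^o), invariant_state T phi /\ extends_from_fix phi omega.

Definition stochastic (p : 'M[R]_d) : Prop :=
  (forall i j, 0 <= p i j) /\ (forall i, \sum_j p i j = 1).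

Definition Fix (p : 'M[R]_d) : {vspace 'cV[C]_d} :=
  fixedSpace (linfun (mulmx (map_mx (real_complex R) p))).

Definition schur (x y : A) : A := map2_mx *%R x y.

Definition P_fun (p : 'M[R]_d) (x : A) : A :=
  \matrix_(i, j) \sum_k \sum_l (Num.sqrt (p i k * p j l))%:C * x k l.

Definition Psi_fun (p : 'M[R]_d) (x : A) : A := schur 1%:M (P_fun p x).

Section Psi.
Variable p : 'M[R]_d.

Fact Psi_fun_linear : linear (Psi_fun p).
Proof.
move=> a x y; apply/matrixP => i j; rewrite !mxE mulrCA -mulrDr; congr (_ * _).
rewrite mulr_sumr -big_split; apply: eq_bigr => k _ /=.
rewrite mulr_sumr -big_split; apply: eq_bigr => l _ /=.
by rewrite !mxE mulrDr mulrCA.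
Qed.

HB.instance Definition _ :=
  GRing.isLinear.Build C A A *:%R (Psi_fun p) Psi_fun_linear.

Hypothesis p_stochastic : stochastic p.

Fact Psi_unital : linfun (Psi_fun p) 1%:M = 1%:M.
Proof.
have [p_ge0 p_sum] := p_stochastic.
rewrite lfunE; apply/matrixP => i j; rewrite !mxE.
have [<-|] := eqVneq i j; last by rewrite mul0r.
rewrite mul1r -[RHS](rmorph1 (real_complex R)) -(p_sum i) rmorph_sum.
apply: eq_bigr => k _; rewrite (bigD1 k) //= big1 => [|l l_neq_k].
  by rewrite !mxE eqxx mulr1 addr0 -expr2 sqrtr_sqr ger0_norm.
by rewrite !mxE eq_sym (negPf l_neq_k) mulr0.
Qed.

Fact Psi_positive x :
  cstar_positive x -> cstar_positive (linfun (Psi_fun p) x).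
Proof.
have [p_ge0 _] := p_stochastic; case=> y ->; rewrite lfunE /=.
set z := P_fun p (y ^t* *m y).
have z_ge0 i : 0 <= z i i.
  pose v m := \sum_k (Num.sqrt (p i k))%:C * y m k.
  suff -> : z i i = \sum_m (v m)^* * v m.
    by apply: sumr_ge0 => m _; rewrite mulrC mul_conjC_ge0.
  rewrite /z mxE; under eq_bigr => k _.
    under eq_bigr => l _ do rewrite mxE mulr_sumr.
    rewrite exchange_big /=; over.
  rewrite exchange_big /=; apply: eq_bigr => m _.
  rewrite rmorph_sum mulr_suml; apply: eq_bigr => k _.
  rewrite mulr_sumr; apply: eq_bigr => l _.
  rewrite !mxE sqrtrM // !rmorphM /= mulrACA; congr (_ * _ * _).
  by rewrite geC0_conj // lecR sqrtr_ge0.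
exists (\matrix_(i, j) ((i == j)%:R * sqrtC (z i i))).
apply/matrixP => i j.
rewrite [LHS]mxE [1%:M _ _]mxE -/z [RHS]mxE (bigD1 i) //=.
clearbody z.
rewrite big1 => [|k k_neq_i].
  rewrite !mxE eqxx mul1r addr0.
  have [<-|] := eqVneq i j; last by rewrite !mul0r mulr0.
  by rewrite !mul1r geC0_conj ?sqrtC_ge0 // -expr2 sqrtCK.
by rewrite !mxE (negPf k_neq_i) mul0r rmorph0 mul0r.
Qed.

Definition Psi : markov_operator := MarkovOperator Psi_positive Psi_unital.

End Psi.

End MarkovOperators.

(* Main.v *)
Require Import Defs.
From mathcomp Require Import all_boot all_order all_algebra.
From mathcomp Require Import complex reals.

(** Telescoping gives [\sum_(k < n) T^k (y - T y) = y - T^n y]. When the orbits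
    of [T] are bounded this forces [Fix T] and [Im (1 - T)] to meet trivially,
    so by rank-nullity they are complementary; an invariant functional vanishes
    on [Im (1 - T)], hence is determined by its restriction to [Fix T].
    Conversely, a state of [Fix T] is extended by composing it with the
    projection [E] onto [Fix T] along [Im (1 - T)]; [E] is positive because
    [n E x] differs from [\sum_(k < n) T^k x] by a bounded quantity. *)

Set Implicit Arguments.
Unset Strict Implicit.
Unset Printing Implicit Defensive.

Import Order.TTheory GRing.Theory Num.Theory.
Local Open Scope ring_scope.
Local Open Scope complex_scope.

(** Archimedean property: if [z] were nonzero, some natural number would exceed the real number
    behind [M / |z|]. *)
Lemma complex_bounded_muln_eq0 (R : realType) (z M : R[i]) :
  (forall n, `|z *+ n| <= M) -> z = 0.
Proof.
move=> bound.
have M_ge0 : 0 <= M by apply: le_trans (bound 0); rewrite normr_ge0.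
apply/eqP; rewrite -normr_le0 real_leNgt ?real0 ?normr_real //.
apply/negP => z_gt0.
pose r := complex.Re (M / `|z|).
have rE : r%:C = M / `|z| by apply: RRe_real; rewrite ger0_real ?divr_ge0.
have r_ge0 : 0 <= r by rewrite -lecR rE divr_ge0.
have := archi_boundP r_ge0; set n := Num.bound r.
rewrite -ltcR rE ltr_pdivrMr // rmorph_nat mulr_natl -normrMn.
by move=> /lt_le_trans /(_ (bound n)); rewrite ltxx.
Qed.

(** Showing [|z| = z] gives reality and nonnegativity at once. The multiples of [|z| - z] stay
    bounded, because [z *+ n + c n] equals its own modulus, which is within [M] of that of
    [z *+ n]. *)
Lemma complex_ge0_approx (R : realType) (z M : R[i]) (c : nat -> R[i]) :
  (forall n, `|c n| <= M) -> (forall n, 0 <= z *+ n + c n) -> 0 <= z.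
Proof.
move=> c_le zc_ge0; suff /subr0_eq <- : `|z| - z = 0 by rewrite normr_ge0.
apply: (@complex_bounded_muln_eq0 _ _ (M + M)) => n.
have -> : (`|z| - z) *+ n = (`|z *+ n| - `|z *+ n + c n|) + c n.
  by rewrite mulrnBl normrMn (ger0_norm (zc_ge0 n)) opprD addrA subrK.
apply: le_trans (ler_normD _ _) _; apply: lerD => //.
apply: le_trans (ler_dist_dist _ _) _.
by rewrite opprD addNKr normrN.
Qed.

Section MeanErgodic.
Variables (K : fieldType) (vT : vectType K) (T : 'End(vT)).

Lemma sum_iter_sub n y :
  \sum_(k < n) iter k T (y - T y) = y - iter n T y.
Proof.
have iterB k u v : iter k T (u - v) = iter k T u - iter k T v.
  by elim: k => //= k ->; rewrite linearB.
elim: n => [|n IHn]; first by rewrite big_ord0 subrr.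
by rewrite big_ord_recr /= IHn iterB -iterSr addrA subrK.
Qed.

Lemma iter_fixed n x : T x = x -> iter n T x = x.
Proof. by move=> Tx; elim: n => //= n ->. Qed.

Lemma sum_iter_fixedD n x y : T x = x ->
  \sum_(k < n) iter k T (x + (y - T y)) = x *+ n + (y - iter n T y).
Proof.
move=> Tx; have iterD k u v : iter k T (u + v) = iter k T u + iter k T v.
  by elim: k => //= k ->; rewrite linearD.
under eq_bigr do rewrite iterD (iter_fixed _ Tx).
by rewrite big_split /= sumr_const card_ord sum_iter_sub.
Qed.

Lemma sub1_lfunE y : (\1 - T)%VF y = y - T y.
Proof. by rewrite !lfunE /= !lfunE. Qed.

Lemma fixedSpace_coboundary_sum :
  (fixedSpace T :&: limg (\1 - T)%VF = 0)%VS ->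
  (fixedSpace T + limg (\1 - T)%VF = fullv)%VS.
Proof.
move=> disj; apply/eqP; rewrite eqEdim subvf dimv_disjoint_sum //=.
(* Rank-nullity reduces the dimension count to the inclusion of the kernel of [1 - T] in the fixed
   space. *)
rewrite -[X in (X <= _)%N](limg_ker_dim (\1 - T)%VF fullv) capfv leq_add2r.
apply: dimvS; apply/subvP => x; rewrite memv_ker sub1_lfunE subr_eq0.
by move=> /eqP Tx; apply/fixedSpaceP.
Qed.

End MeanErgodic.

Lemma fixedSpace_coboundary_cap (R : realType) (m n : nat)
    (T : 'End('M[R[i]]_(m, n))) :
  (forall y, exists M : R[i], forall k i j, `|iter k T y i j| <= M) ->
  (fixedSpace T :&: limg (\1 - T)%VF = 0)%VS.
Proof.
move=> bounded; apply/eqP; rewrite -subv0; apply/subvP => x.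
rewrite memv_cap memv0 => /andP [/fixedSpaceP Tx /memv_imgP [y _]].
rewrite sub1_lfunE => xE; apply/eqP/matrixP => i j; rewrite mxE.
have [M yM] := bounded y.
apply: (@complex_bounded_muln_eq0 _ _ (M + M)) => k.
have := sum_iter_sub T k y; rewrite -xE.
under eq_bigr do rewrite (iter_fixed _ Tx).
rewrite sumr_const card_ord => /matrixP /(_ i j); rewrite mulmxnE !mxE => ->.
apply: le_trans (ler_normB _ _) _; apply: lerD (yM k i j).
exact: (yM 0).
Qed.

Section Psi.
Variables (R : realType) (d : nat) (p : 'M[R]_d).
Hypothesis p_stochastic : stochastic p.
Local Notation T := (Psi p_stochastic).
Implicit Types x y : 'M[R[i]]_d.

Lemma Psi_offdiag x i j : i != j -> T x i j = 0.
Proof. by move=> /negPf ij; rewrite lfunE /= !mxE ij mul0r. Qed.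

Lemma Psi_diag x i : (forall k l, k != l -> x k l = 0) ->
  T x i i = \sum_k (p i k)%:C * x k k.
Proof.
have [p_ge0 _] := p_stochastic.
move=> x_diag; rewrite lfunE /= !mxE eqxx mul1r; apply: eq_bigr => k _.
rewrite (bigD1 k) //= big1 ?addr0 => [|l l_neq_k].
  by rewrite -expr2 sqrtr_sqr ger0_norm.
by rewrite x_diag ?mulr0 // eq_sym.
Qed.

(** On diagonal matrices [T] acts on the diagonal as the stochastic matrix [p], so each new diagonal
    entry is a convex combination of old ones. For general [x] the entrywise bound can grow. *)
Lemma Psi_bounded x M : (forall k l, k != l -> x k l = 0) ->
  (forall i j, `|x i j| <= M) -> forall i j, `|T x i j| <= M.
Proof.
have [p_ge0 p_sum] := p_stochastic.
move=> x_diag xM i j; have [<-|ij] := eqVneq i j; last first.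
  by rewrite Psi_offdiag // normr0; apply: le_trans (xM i j).
rewrite Psi_diag //; apply: le_trans (ler_norm_sum _ _ _) _.
have -> : M = \sum_k (p i k)%:C * M.
  by rewrite -mulr_suml -rmorph_sum p_sum mul1r.
apply: ler_sum => k _; rewrite normrM.
have pC_ge0 : 0 <= (p i k)%:C by rewrite lecR.
by rewrite (ger0_norm pC_ge0) ler_wpM2l.
Qed.

Lemma Psi_orbit_bounded y : exists M : R[i], forall k i j, `|iter k T y i j| <= M.
Proof.
pose N x := \sum_i \sum_j `|x i j : R[i]|.
have N_ge0 x : 0 <= N x by apply: sumr_ge0 => i _; apply: sumr_ge0.
have le_N x i j : `|x i j| <= N x.
  rewrite /N (bigD1 i) //= (bigD1 j) //= -addrA lerDl addr_ge0 //.
    exact: sumr_ge0.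
  by apply: sumr_ge0 => k _; apply: sumr_ge0.
(* [y] need not be diagonal, so [N y] covers only the iterate [k = 0]; from [T y] on, all iterates
   are diagonal and [N (T y)] propagates. *)
exists (N y + N (T y)) => k i j; case: k => [|k].
  by apply: le_trans (le_N _ _ _) _; rewrite lerDl.
suff : `|iter k.+1 T y i j| <= N (T y).
  by move=> /le_trans; apply; rewrite lerDr.
elim: k i j => [|k IHk] i j; first exact: le_N.
by apply: Psi_bounded => // a b; apply: Psi_offdiag.
Qed.

Lemma cstar_positive_diag_ge0 x i : cstar_positive x -> 0 <= x i i.
Proof.
case=> y ->; rewrite mxE; apply: sumr_ge0 => k _.
by rewrite !mxE mulrC mul_conjC_ge0.
Qed.

Lemma diag_cstar_positive x : (forall i j, i != j -> x i j = 0) ->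
  (forall i, 0 <= x i i) -> cstar_positive x.
Proof.
move=> x_diag x_ge0; exists (\matrix_(i, j) ((i == j)%:R * sqrtC (x i i))).
apply/matrixP => i j; rewrite !mxE (bigD1 i) //= big1 => [|k /negPf k_neq_i].
  rewrite !mxE eqxx mul1r addr0.
  have [<-|ij] := eqVneq i j; last by rewrite x_diag // mul0r mulr0.
  by rewrite mul1r geC0_conj ?sqrtC_ge0 // -expr2 sqrtCK.
by rewrite !mxE k_neq_i mul0r rmorph0 mul0r.
Qed.

Lemma iter_Psi_positive k x : cstar_positive x -> cstar_positive (iter k T x).
Proof. by move=> x_pos; elim: k => //= k; apply: (markov_positive T). Qed.

(** This is the positivity of the projection [E]. A fixed [x] is diagonal, so only the signs of its
    diagonal entries matter. Summing [n] iterates of the positive matrix gives diagonal entries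
    [x i i *+ n] up to a bounded error, and these sums are nonnegative. *)
Lemma fixed_part_positive x y : T x = x ->
  cstar_positive (x + (y - T y)) -> cstar_positive x.
Proof.
move=> Tx pos; apply: diag_cstar_positive => [i j ij|i].
  by rewrite -Tx Psi_offdiag.
have [M yM] := Psi_orbit_bounded y.
apply: (@complex_ge0_approx _ _ (M + M) (fun n => (y - iter n T y) i i)) => n.
  rewrite !mxE; apply: le_trans (ler_normB _ _) _; apply: lerD (yM n i i).
  exact: (yM 0).
have /matrixP/(_ i i) := sum_iter_fixedD n y Tx.
rewrite [RHS]mxE mulmxnE => <-; rewrite summxE; apply: sumr_ge0 => k _.
exact/cstar_positive_diag_ge0/iter_Psi_positive.
Qed.

End Psi.

Theorem theorem4p2 (R : realType) (d : nat) (p : 'M[R]_d)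
    (p_stochastic : stochastic p) (dim_fix : (2 <= \dim (Fix p))%N) :
  uniquely_ergodic_rel_fix (Psi p_stochastic).
Proof.
move=> omega [omega_pos omega1].
set T := Psi p_stochastic.
set F := fixedSpace T; set B := limg (\1 - (T : 'End('M[R[i]]_d)))%VF.
have FB0 : (F :&: B = 0)%VS.
  exact: fixedSpace_coboundary_cap (Psi_orbit_bounded p_stochastic).
have FB1 : (F + B = fullv)%VS by exact: fixedSpace_coboundary_sum.
pose E := daddv_pi F B.
have E_fix x : x \in F -> E x = x by exact: daddv_pi_id.
have ET x : T (E x) = E x by apply/fixedSpaceP/memv_pi.
have dec x : exists y, x = E x + (y - T y).
  have : daddv_pi B F x \in B by exact: memv_pi.
  move=> /memv_imgP [y _]; rewrite sub1_lfunE => yE.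
  by exists y; rewrite -yE daddv_pi_add // FB1 memvf.
pose phi : 'Hom('M[R[i]]_d, (R[i])^o) := (omega \o (linfun (vsproj F) \o E))%VF.
have phiE x : phi x = omega (vsproj F (E x)) by rewrite !lfunE /= !lfunE /= lfunE.
exists phi; split.
  split; last by move=> x; rewrite phiE E_fix ?subvsP // vsvalK.
  split; first split.
  - move=> x x_pos; rewrite phiE; apply: omega_pos.
    rewrite vsprojK ?memv_pi //; have [y xE] := dec x.
    by apply: (@fixed_part_positive _ _ _ p_stochastic _ y); rewrite // -xE.
  - rewrite phiE E_fix ?one_in_fixedSpace // -[RHS]omega1; congr (omega _).
    exact/esym/SubvsE.
  - move=> x; rewrite !phiE; congr (omega (vsproj F _)).
    (* Invariance of [phi] amounts to [E] killing [x - T x]. That element lies in [B], so its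
       [B]-component is already all of it and its [F]-component vanishes. *)
    apply/eqP; rewrite eq_sym -subr_eq0 -linearB /=; apply/eqP.
    have xB : x - T x \in B.
      by apply/memv_imgP; exists x; rewrite ?memvf // sub1_lfunE.
    apply: (addIr (daddv_pi B F (x - T x))).
    by rewrite daddv_pi_add ?FB1 ?memvf // add0r daddv_pi_id // capvC.
move=> psi [[_ psi_inv] psi_ext]; apply/lfunP => x; rewrite phiE -psi_ext.
(* An invariant [psi] takes equal values at [y] and [T y], so [psi x = psi (E x)], which [omega]
   prescribes. *)
rewrite vsprojK ?memv_pi //; have [y {2}->] := dec x.
by rewrite linearD linearB /= psi_inv subrr addr0.
Qed.
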